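(* Consider the robust two-stage combinatorial optimization problem $\textsc{Rob}$ with two-stage discrete budgeted uncertainty, and suppose that the polyhedron $P=\{x\in[0,1]^n: Ax\ge b\}$ is integral. Then $\textsc{Rob}$ can be formulated as the following compact mixed-integer program (i.e. the optimal value of this program equals $\textsc{Rob}$): $$\min\ t$$ subject to $$t\ \ge\ (\Gamma-\gamma)\kappa_\gamma+\sum_{i\in[n]}\rho^{(2)}_{\gamma,i}+\sum_{i\in[n]}\underline{d}_iy^{(\gamma)}_i+\gamma\pi^{(\gamma)}+\sum_{i\in[n]}\rho^{(\gamma)}_i+\sum_{i\in[n]}\underline{c}_ix_i\qquad\forall\gamma\in[\Gamma]_0,$$ $$A(x+y^{(\gamma)})\ge b,\qquad x+y^{(\gamma)}\le\mathbf{1}\qquad\forall\gamma\in[\Gamma]_0,$$ $$\kappa_\gamma+\rho^{(2)}_{\gamma,i}\ge(\overline{d}_i-\underline{d}_i)y^{(\gamma)}_i,\qquad \pi^{(\gamma)}+\rho^{(\gamma)}_i\ge(\overline{c}_i-\underline{c}_i)x_i\qquad\forall\gamma\in[\Gamma]_0,\ i\in[n],$$ $$x_i\in\{0,1\},\quad y^{(\gamma)}_i\in\{0,1\},\quad \pi^{(\gamma)},\kappa_\gamma\ge0,\quad \rho^{(\gamma)}_i,\rho^{(2)}_{\gamma,i}\ge0\qquad\forall\gamma\in[\Gamma]_0,\ i\in[n].$$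
   Context: Notation: $[n]=\{1,\dots,n\}$, $[\Gamma]_0=\{0,1,\dots,\Gamma\}$, $\min\emptyset=\infty$. Nominal data: $A\in\mathbb{R}^{m\times n}$, $b\in\mathbb{R}^m$, with nominal feasible set $\{x\in\{0,1\}^n: Ax\ge b\}$. Put $\mathcal{X}=\{0,1\}^n$ and $\mathcal{X}(x)=\{y\in\{0,1\}^n: A(x+y)\ge b,\ x+y\le\mathbf{1}\}$. Two-stage discrete budgeted uncertainty: given $0\le\underline{c}_i\le\overline{c}_i$, $0\le\underline{d}_i\le\overline{d}_i$ ($i\in[n]$) and an integer $\Gamma\ge0$, $$\mathcal{U}=\{c\in\mathbb{R}^n_+: c_i=\underline{c}_i+(\overline{c}_i-\underline{c}_i)\delta_i,\ \delta_i\in\{0,1\}\ \forall i\in[n],\ \textstyle\sum_{i}\delta_i\le\Gamma\},$$ $$\mathcal{U}(c)=\{d\in\mathbb{R}^n_+: d_i=\underline{d}_i+(\overline{d}_i-\underline{d}_i)\delta_i,\ \delta_i\in\{0,1\}\ \forall i\in[n],\ \textstyle\sum_i\delta_i\le\Gamma-\sum_{i}\frac{c_i-\underline{c}_i}{\overline{c}_i-\underline{c}_i}\},$$ where a fraction with $\overline{c}_i=\underline{c}_i$ is read as $0$. The robust problem is $$\textsc{Rob}=\min_{x\in\mathcal{X}}\max_{c\in\mathcal{U}}\min_{y\in\mathcal{X}(x)}\max_{d\in\mathcal{U}(c)} c^tx+d^ty .$$ *)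

(* Defs.v *)
From HB Require Import structures.
From mathcomp Require Import all_boot all_order all_algebra.
From mathcomp Require Import boolp classical_sets reals ereal convex.

Set Implicit Arguments.
Unset Strict Implicit.
Unset Printing Implicit Defensive.

Import Order.TTheory GRing.Theory Num.Theory.
Local Open Scope classical_set_scope.
Local Open Scope ring_scope.

(* A vector of R^n is a column 'cV[R]_n; its i-th entry is x i 0. *)

Definition le_vec (R : realType) (n : nat) (u v : 'cV[R]_n) : Prop :=
  forall i, u i 0 <= v i 0.

Definition dot (R : realType) (n : nat) (u v : 'cV[R]_n) : R :=
  \sum_i u i 0 * v i 0.

Definition binary_vecs (R : realType) (n : nat) : set 'cV[R]_n :=
  [set x | forall i, x i 0 = 0 \/ x i 0 = 1].

Definition conv_hull (R : realType) (n : nat) (S : set 'cV[R]_n) :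
    set 'cV[R]_n :=
  smallest (fun C : set (convex_lmodType 'cV[R]_n) => convex_set C) S.

Definition integer_points (R : realType) (n : nat) : set 'cV[R]_n :=
  [set x | x \is a mxOver Num.int].

Definition integral_polyhedron (R : realType) (n : nat) (P : set 'cV[R]_n) :
    Prop :=
  P = conv_hull (P `&` @integer_points R n).

Definition box_polyhedron (R : realType) (m n : nat)
    (A : 'M[R]_(m, n)) (b : 'cV[R]_m) : set 'cV[R]_n :=
  [set x | [/\ le_vec 0 x, le_vec x (const_mx 1) & le_vec b (A *m x)]].

Definition second_stage (R : realType) (m n : nat)
    (A : 'M[R]_(m, n)) (b : 'cV[R]_m) (x : 'cV[R]_n) : set 'cV[R]_n :=
  [set y | [/\ @binary_vecs R n y, le_vec b (A *m (x + y)) &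
               le_vec (x + y) (const_mx 1)]].

Definition budgeted_costs (R : realType) (n : nat)
    (lo hi : 'cV[R]_n) (B : R) : set 'cV[R]_n :=
  [set c | le_vec 0 c /\
    exists delta : 'cV[R]_n,
      [/\ @binary_vecs R n delta,
          forall i, c i 0 = lo i 0 + (hi i 0 - lo i 0) * delta i 0 &
          \sum_i delta i 0 <= B]].

Definition first_costs (R : realType) (n : nat) (clo chi : 'cV[R]_n)
    (Gamma : nat) : set 'cV[R]_n :=
  budgeted_costs clo chi Gamma%:R.

(* Since u / 0 = 0 in a field, a fraction with chi i 0 = clo i 0 is 0. *)
Definition second_costs (R : realType) (n : nat)
    (clo chi dlo dhi : 'cV[R]_n) (Gamma : nat) (c : 'cV[R]_n) :
    set 'cV[R]_n :=
  budgeted_costs dlo dhi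
    (Gamma%:R - \sum_i (c i 0 - clo i 0) / (chi i 0 - clo i 0)).

(* The four sets ranged over are finite, so every infimum and supremum below
   is a minimum or maximum, except that second_stage A b x may be empty, in
   which case the inner infimum is +oo.  The two cost sets that occur are
   never empty when the bounds are nonnegative. *)
Definition Rob (R : realType) (m n : nat)
    (A : 'M[R]_(m, n)) (b : 'cV[R]_m) (clo chi dlo dhi : 'cV[R]_n)
    (Gamma : nat) : \bar R :=
  ereal_inf [set
    ereal_sup [set
      ereal_inf [set
        ereal_sup [set (dot c x + dot d y)%:E
          | d in second_costs clo chi dlo dhi Gamma c]
        | y in second_stage A b x]
      | c in first_costs clo chi Gamma]
    | x in @binary_vecs R n].

Definition mip_feasible (R : realType) (m n : nat)
    (A : 'M[R]_(m, n)) (b : 'cV[R]_m) (clo chi dlo dhi : 'cV[R]_n)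
    (Gamma : nat) (t : R) (x : 'cV[R]_n)
    (y : 'I_Gamma.+1 -> 'cV[R]_n)
    (kappa pi : 'I_Gamma.+1 -> R)
    (rho rho2 : 'I_Gamma.+1 -> 'I_n -> R) : Prop :=
  @binary_vecs R n x /\
  forall g : 'I_Gamma.+1,
    [/\ t >= (Gamma%:R - g%:R) * kappa g + \sum_i rho2 g i
             + \sum_i dlo i 0 * y g i 0
             + g%:R * pi g + \sum_i rho g i
             + \sum_i clo i 0 * x i 0,
        le_vec b (A *m (x + y g)) /\ le_vec (x + y g) (const_mx 1),
        forall i, kappa g + rho2 g i >= (dhi i 0 - dlo i 0) * y g i 0
               /\ pi g + rho g i >= (chi i 0 - clo i 0) * x i 0,
        @binary_vecs R n (y g) &
        [/\ 0 <= pi g, 0 <= kappa g &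
            forall i, 0 <= rho g i /\ 0 <= rho2 g i]].

Definition mip_values (R : realType) (m n : nat)
    (A : 'M[R]_(m, n)) (b : 'cV[R]_m) (clo chi dlo dhi : 'cV[R]_n)
    (Gamma : nat) : set (\bar R) :=
  [set t%:E | t in [set t : R |
    exists x y kappa pi rho rho2,
      @mip_feasible R m n A b clo chi dlo dhi Gamma t x y kappa pi rho rho2]].

(* v is the minimum of V, with the convention min set0 = +oo. *)
Definition is_min (R : realType) (V : set (\bar R)) (v : \bar R) : Prop :=
  ereal_inf V = v /\ (V !=set0 -> V v).

(* Main.v *)
Require Import Defs.
From mathcomp Require Import all_boot all_order all_algebra lra.
From mathcomp Require Import boolp classical_sets reals ereal.

Import Order.TTheory GRing.Theory Num.Theory.
Local Open Scope classical_set_scope.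
Local Open Scope ring_scope.

(** Once [x] is fixed, the first-stage costs enter the remaining game only
    through the constant [dot c x] and through the number [g] of budget units
    that they spend.  Hence the second-stage reaction needs to be chosen only
    once for each [g] in [0, Gamma], not once for each of the exponentially
    many scenarios [c]; this is the vector [y g] of the program.

    For fixed [g], [x] and [y] the adversary solves two independent problems
    of one kind: raise at most [k] cost coefficients, where raising the [i]-th
    one gains [w i >= 0].  Linear programming duality turns the maximal gain
    into the minimum of [k * pi + \sum_i rho i] subject to
    [pi + rho i >= w i] and [pi, rho >= 0]; it is applied with [k = g] to the
    first stage and with [k = Gamma - g] to the second
    ([budgeted_weak_duality], [budgeted_strong_duality]).

    Weak duality shows that every feasible point of the program bounds [Rob]
    from above: against a scenario that spends exactly [g] units, answer with
    [y g] ([Rob_le_mip]).  Conversely, take an optimal [x]; for each [g] let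
    the adversary play an optimal set of at most [g] first-stage deviations,
    let [y g] be an optimal answer to it, and let the adversary complete the
    play by an optimal set of at most [Gamma - g] second-stage deviations.
    The latter is affordable since at most [g] units were spent, so this play
    costs at most [Rob], and by strong duality its cost is the right-hand side
    of the [g]-th constraint: [t = Rob] is feasible ([Rob_mip_value]). *)

Lemma budgeted_weak_duality (R : realDomainType) (n k : nat)
    (w rho : 'I_n -> R) (pi : R) (S : {set 'I_n}) :
  (#|S| <= k)%N -> 0 <= pi -> (forall i, 0 <= rho i) ->
  (forall i, w i <= pi + rho i) ->
  \sum_(i in S) w i <= k%:R * pi + \sum_i rho i.
Proof.
move=> leSk pi0 rho0 wle.
apply: le_trans (ler_sum _ (fun i _ => wle i)) _.
rewrite big_split /= sumr_const -[pi *+ _]mulr_natl; apply: lerD.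
  by apply: ler_wpM2r => //; rewrite ler_nat.
rewrite [leRHS](bigID (fun i => i \in S)) /= lerDl.
exact: sumr_ge0.
Qed.

(** For [k < n] the primal optimum is a set [S] of [k] largest weights; the
    largest weight outside [S] is then the threshold [pi], and [rho] is the
    excess of the members of [S] over it.  For [n <= k] all indices are taken
    and the threshold is 0. *)
Lemma budgeted_strong_duality (R : realDomainType) (n k : nat) (w : 'I_n -> R) :
  (forall i, 0 <= w i) ->
  exists (S : {set 'I_n}) (pi : R) (rho : 'I_n -> R),
    [/\ (#|S| <= k)%N, 0 <= pi, forall i, 0 <= rho i,
        forall i, w i <= pi + rho i &
        k%:R * pi + \sum_i rho i = \sum_(i in S) w i].
Proof.
move=> w0; have [nk|kn] := leqP n k.
  exists [set: 'I_n]%SET, 0, w; split=> //; first by rewrite cardsT card_ord.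
    by move=> i; rewrite add0r.
  by rewrite mulr0 add0r; apply: eq_bigl => i; rewrite inE.
have [S0 cS0] : exists S : {set 'I_n}, #|S| == k.
  exists [set i in take k (enum 'I_n)]%SET.
  rewrite cardsE (card_uniqP _) ?take_uniq ?enum_uniq //.
  by rewrite size_takel // size_enum_ord ltnW.
have [S /eqP cS Smax] := @arg_maxP _ _ _ S0
  (fun S : {set 'I_n} => #|S| == k) (fun S => \sum_(i in S) w i) cS0.
have [j0 j0S] : exists j, j \notin S.
  apply/existsP; rewrite -negb_forall; apply: contraTN kn => /forallP SP.
  have -> : n = #|S|.
    by rewrite -[LHS]card_ord; apply: eq_card => i; rewrite SP.
  by rewrite cS ltnn.
have [j jS jmax] := @arg_maxP _ _ _ j0 (fun j => j \notin S) w j0S.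
(* Replacing [i] by [j] in [S] keeps the cardinality, so it cannot increase
   the total weight. *)
have exch i : i \in S -> w j <= w i.
  move=> iS; have jSi : j \notin S :\ i by rewrite !inE negb_and jS orbT.
  have cSij : #|j |: (S :\ i)| == k.
    by rewrite cardsU1 jSi -cS (cardsD1 i S) iS.
  have := Smax _ cSij.
  by rewrite big_setU1 //= [leRHS](big_setD1 i iS) /= lerD2r.
(* [exch] makes this [rho] nonnegative, and the choice of [j] makes it
   feasible outside [S]. *)
exists S, (w j), (fun i => if i \in S then w i - w j else 0); split=> //.
- by rewrite cS.
- by move=> i; case: ifP => // iS; rewrite subr_ge0 exch.
- move=> i; case: ifPn => iS; first by rewrite addrC subrK.
  by rewrite addr0; exact: jmax.
- rewrite -big_mkcond /= sumrB sumr_const cS -[w j *+ _]mulr_natl.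
  by rewrite addrC subrK.
Qed.

Definition deviated {R : realType} {n : nat} (lo hi : 'cV[R]_n)
    (S : {set 'I_n}) : 'cV[R]_n :=
  \col_i (lo i 0 + (if i \in S then hi i 0 - lo i 0 else 0)).

Lemma dot_deviated (R : realType) (n : nat) (lo hi x : 'cV[R]_n)
    (S : {set 'I_n}) :
  dot (deviated lo hi S) x
    = dot lo x + \sum_(i in S) (hi i 0 - lo i 0) * x i 0.
Proof.
rewrite /dot [X in _ + X]big_mkcond /= -big_split /=.
by apply: eq_bigr => i _; rewrite mxE mulrDl; case: ifP; rewrite ?mul0r.
Qed.

Lemma budgeted_costsP (R : realType) (n : nat) (lo hi d : 'cV[R]_n) (B : R) :
  (forall i, 0 <= lo i 0 <= hi i 0) ->
  budgeted_costs lo hi B d <->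
  exists2 S : {set 'I_n}, #|S|%:R <= B & d = deviated lo hi S.
Proof.
move=> lohi; split=> [[_ [delta [bin dE sumB]]]|[S cS ->]].
  exists [set i | delta i 0 == 1]%SET.
    apply: le_trans sumB; rewrite -sum1_card natr_sum big_mkcond /=.
    apply: ler_sum => i _; rewrite inE.
    by case: (bin i) => ->; rewrite ?eqxx // eq_sym oner_eq0.
  apply/matrixP => i j; rewrite (ord1 j) mxE dE inE.
  by case: (bin i) => ->; rewrite ?eqxx ?mulr1 // eq_sym oner_eq0 mulr0.
split.
  move=> i; rewrite !mxE; have /andP[lo0 lehi] := lohi i.
  by case: ifP => _; rewrite ?addr0 // addrC subrK (le_trans lo0).
exists (\col_i (i \in S)%:R); split.
- by move=> i; rewrite mxE; case: (i \in S); [right|left].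
- by move=> i; rewrite !mxE; case: (i \in S); rewrite ?mulr1 ?mulr0.
- apply: le_trans cS; rewrite -sum1_card natr_sum [leRHS]big_mkcond /=.
  by apply: ler_sum => i _; rewrite mxE; case: (i \in S).
Qed.

(** Deviations that change a cost: raising a coefficient with [hi = lo] leaves
    the scenario unchanged and is not charged to the budget, because its
    fraction is read as 0. *)
Definition effective {R : realType} {n : nat} (lo hi : 'cV[R]_n)
    (S : {set 'I_n}) : {set 'I_n} :=
  [set i in S | hi i 0 != lo i 0]%SET.

Lemma deviated_effective (R : realType) (n : nat) (lo hi : 'cV[R]_n)
    (S : {set 'I_n}) :
  deviated lo hi (effective lo hi S) = deviated lo hi S.
Proof.
apply/matrixP => i j; rewrite !mxE inE; case: (i \in S) => //=.
by case: eqP => //= ->; rewrite subrr.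
Qed.

Lemma effective_le (R : realType) (n : nat) (lo hi : 'cV[R]_n)
    (S : {set 'I_n}) : (#|effective lo hi S| <= #|S|)%N.
Proof.
by apply/subset_leq_card/fintype.subsetP => i; rewrite inE => /andP[].
Qed.

Lemma spent_budget (R : realType) (n : nat) (lo hi : 'cV[R]_n)
    (S : {set 'I_n}) :
  \sum_i (deviated lo hi S i 0 - lo i 0) / (hi i 0 - lo i 0)
    = #|effective lo hi S|%:R.
Proof.
rewrite -sum1_card natr_sum [RHS]big_mkcond /=; apply: eq_bigr => i _.
rewrite mxE addrC addrA addNr add0r inE; case: (i \in S); last by rewrite mul0r.
have [->|ne] := eqVneq; first by rewrite subrr mul0r.
by rewrite divff // subr_eq0.
Qed.

(** An infimum over 0/1-vectors ranges over finitely many values, those of the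
    subsets of the index set; finiteness of the infimum excludes the empty
    family. *)
Lemma ereal_inf_binary_attained (R : realType) (n : nat) (D : set 'cV[R]_n)
    (f : 'cV[R]_n -> \bar R) :
  D `<=` @binary_vecs R n -> (ereal_inf (f @` D) < +oo)%E ->
  exists2 x, D x & (f x <= ereal_inf (f @` D))%E.
Proof.
move=> Dbin finf; pose v (S : {set 'I_n}) : 'cV[R]_n := \col_i (i \in S)%:R.
have Dv x : D x -> exists S, x = v S.
  move=> /Dbin xbin; exists [set i | x i 0 == 1]%SET.
  apply/matrixP => i j; rewrite (ord1 j) mxE inE.
  by case: (xbin i) => ->; rewrite ?eqxx // eq_sym oner_eq0.
have [x0 Dx0] : D !=set0.
  apply/set0P; apply: contraTneq finf => ->.
  by rewrite image_set0 ereal_inf0 ltxx.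
have [S0 x0E] := Dv _ Dx0.
have PS0 : `[< D (v S0) >] by apply/asboolP; rewrite -x0E.
have [S /asboolP DS Smin] := @arg_minP _ _ _ S0
  (fun S => `[< D (v S) >]) (fun S => f (v S)) PS0.
exists (v S) => //; apply: le_ereal_inf_tmp => _ [x Dx <-].
have [T xE] := Dv _ Dx.
by rewrite xE; apply: Smin; apply/asboolP; rewrite -xE.
Qed.

Lemma second_costsP (R : realType) (n : nat) (clo chi dlo dhi d : 'cV[R]_n)
    (Gamma : nat) (S : {set 'I_n}) :
  (forall i, 0 <= dlo i 0 <= dhi i 0) -> (#|S| <= Gamma)%N ->
  second_costs clo chi dlo dhi Gamma (deviated clo chi S) d <->
  exists2 T : {set 'I_n},
    (#|T| <= Gamma - #|effective clo chi S|)%N & d = deviated dlo dhi T.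
Proof.
move=> hd cS; rewrite /second_costs spent_budget.
rewrite -natrB ?(leq_trans (effective_le _ _ _ _ S)) //.
rewrite (budgeted_costsP _ _ _ _ _ _ hd).
by split=> -[T cT ->]; exists T; rewrite // ler_nat in cT *.
Qed.

(** The answer to a first-stage scenario is [y g] for the number [g] of its
    effective deviations, so that the second stage is left with exactly the
    budget [Gamma - g] of the [g]-th constraint. *)
Lemma Rob_le_mip (R : realType) (m n : nat)
    (A : 'M[R]_(m, n)) (b : 'cV[R]_m) (clo chi dlo dhi : 'cV[R]_n)
    (Gamma : nat) (v : \bar R) :
  (forall i, 0 <= clo i 0 <= chi i 0) -> (forall i, 0 <= dlo i 0 <= dhi i 0) ->
  mip_values A b clo chi dlo dhi Gamma v ->
  (Rob A b clo chi dlo dhi Gamma <= v)%E.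
Proof.
move=> hc hd [t [x [y [kappa [pi [rho [rho2 [xbin feas]]]]]]] <-].
apply: ge_ereal_inf; eexists; first by exists x.
apply: ge_ereal_sup => _ [c /(budgeted_costsP _ _ _ _ _ _ hc)[S cS ->] <-].
rewrite ler_nat in cS.
pose E := effective clo chi S.
have cE : (#|E| <= Gamma)%N := leq_trans (effective_le _ _ _ _ S) cS.
have ltE : (#|E| < Gamma.+1)%N by [].
pose g := Ordinal ltE.
have [tge [Ay xy] dual ybin [pi0 kappa0 rho0]] := feas g.
apply: ge_ereal_inf; eexists; first by exists (y g); first by split.
apply: ge_ereal_sup => _ [d dU <-].
have /(second_costsP _ _ _ _ _ _ _ _ _ hd cS)[T cT ->] := dU.
rewrite lee_fin; apply: le_trans tge.
(* Weak duality needs the set of effective deviations: [S] itself may have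
   more than [g] elements. *)
rewrite -deviated_effective !dot_deviated -/E.
have wc := budgeted_weak_duality _ _ _
  (fun i => (chi i 0 - clo i 0) * x i 0) (rho g) (pi g) _
  (leqnn #|E|) pi0 (fun i => (rho0 i).1) (fun i => (dual i).2).
have wd := budgeted_weak_duality _ _ _
  (fun i => (dhi i 0 - dlo i 0) * y g i 0) (rho2 g) (kappa g) _
  cT kappa0 (fun i => (rho0 i).2) (fun i => (dual i).1).
rewrite natrB // in wd; rewrite -!/(dot _ _) (_ : g%:R = #|E|%:R) //; lra.
Qed.

(** The optimal plays described at the top give, for each [g], a vector [y g]
    and dual variables whose constraint has a right-hand side [t <= Rob].
    The hypothesis excludes the case where no [x] can be completed. *)
Lemma Rob_mip_value (R : realType) (m n : nat)
    (A : 'M[R]_(m, n)) (b : 'cV[R]_m) (clo chi dlo dhi : 'cV[R]_n)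
    (Gamma : nat) :
  (forall i, 0 <= clo i 0 <= chi i 0) -> (forall i, 0 <= dlo i 0 <= dhi i 0) ->
  (Rob A b clo chi dlo dhi Gamma < +oo)%E ->
  mip_values A b clo chi dlo dhi Gamma (Rob A b clo chi dlo dhi Gamma).
Proof.
move=> hc hd Rfin.
have binary_ge0 (z : 'cV[R]_n) i : binary_vecs z -> 0 <= z i 0.
  by move=> /(_ i)[] ->.
have [x xbin xle] := ereal_inf_binary_attained _ _ _ _ (fun _ => id) Rfin.
have stage (g : 'I_Gamma.+1) :
    exists (y : 'cV[R]_n) (kappa pi : R) (rho rho2 : 'I_n -> R) (t : R),
    [/\ (t%:E <= Rob A b clo chi dlo dhi Gamma)%E,
        t = (Gamma%:R - g%:R) * kappa + \sum_i rho2 i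
             + \sum_i dlo i 0 * y i 0 + g%:R * pi + \sum_i rho i
             + \sum_i clo i 0 * x i 0,
        second_stage A b x y,
        forall i, kappa + rho2 i >= (dhi i 0 - dlo i 0) * y i 0
               /\ pi + rho i >= (chi i 0 - clo i 0) * x i 0 &
        [/\ 0 <= pi, 0 <= kappa & forall i : 'I_n, 0 <= rho i /\ 0 <= rho2 i]].
  have gG : (g <= Gamma)%N by rewrite -ltnS.
  have wc0 i : 0 <= (chi i 0 - clo i 0) * x i 0.
    apply: mulr_ge0; last exact: binary_ge0.
    by rewrite subr_ge0; have /andP[] := hc i.
  have [S [pi [rho [cS pi0 rho0 wc cE]]]] :=
    budgeted_strong_duality _ _ g _ wc0.
  have cSG := leq_trans cS gG.
  have cin : first_costs clo chi Gamma (deviated clo chi S).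
    by apply/(budgeted_costsP _ _ _ _ _ _ hc); exists S => //; rewrite ler_nat.
  have infle := le_trans (ereal_sup_ubound (imageP _ cin)) xle.
  have ybin : second_stage A b x `<=` @binary_vecs R n by move=> z [].
  have [y yX yle] :=
    ereal_inf_binary_attained _ _ _ _ ybin (le_lt_trans infle Rfin).
  have wd0 i : 0 <= (dhi i 0 - dlo i 0) * y i 0.
    apply: mulr_ge0; last by apply/binary_ge0/ybin.
    by rewrite subr_ge0; have /andP[] := hd i.
  have [T [kappa [rho2 [cT kappa0 rho20 wd dE]]]] :=
    budgeted_strong_duality _ _ (Gamma - g) _ wd0.
  have din : second_costs clo chi dlo dhi Gamma (deviated clo chi S)
               (deviated dlo dhi T).
    apply/second_costsP => //; exists T => //.
    apply: leq_trans cT _; apply: leq_sub2l.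
    exact: leq_trans (effective_le _ _ _ _ S) cS.
  have tle := le_trans (le_trans (ereal_sup_ubound (imageP _ din)) yle) infle.
  exists y, kappa, pi, rho, rho2; eexists; split; [exact: tle| |by []| |] => //.
  rewrite natrB // in dE; rewrite !dot_deviated -cE -dE -!/(dot _ _); lra.
have [y /choice[kappa /choice[pi /choice[rho /choice[rho2 /choice[t st]]]]]] :=
  choice stage.
(* Some real [t] lies below [Rob], so [Rob] is not -oo. *)
have [R0 _ _ _ _] := st ord0.
case RE: (Rob A b clo chi dlo dhi Gamma) Rfin R0 => [r| |] // _ _.
exists r => //; exists x, y, kappa, pi, rho, rho2; split=> // g.
have [tle tE [yb Ay xy] dual sgn] := st g.
by split => //; rewrite -tE -lee_fin -RE.
Qed.

Theorem theorem17 (R : realType) (m n : nat)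
    (A : 'M[R]_(m, n)) (b : 'cV[R]_m)
    (clo chi dlo dhi : 'cV[R]_n) (Gamma : nat)
    (hc : forall i, 0 <= clo i 0 <= chi i 0)
    (hd : forall i, 0 <= dlo i 0 <= dhi i 0)
    (hP : integral_polyhedron (box_polyhedron A b)) :
  is_min (mip_values A b clo chi dlo dhi Gamma)
         (Rob A b clo chi dlo dhi Gamma).
Proof.
set V := mip_values _ _ _ _ _ _ _; set v := Rob _ _ _ _ _ _ _.
have lower w : V w -> (v <= w)%E by apply: Rob_le_mip.
have [vfin|vinf] := ltP v +oo%E.
  have Vv : V v by apply: Rob_mip_value.
  split=> //; apply/eqP; rewrite eq_le ereal_inf_lbound //=.
  exact: le_ereal_inf_tmp.
have V0 : V = set0.
  rewrite -subset0 => w Vw; have := le_trans vinf (lower _ Vw).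
  by case: Vw => t _ <-.
split; last by rewrite V0 => -[].
by rewrite V0 ereal_inf0; apply/esym/eqP; rewrite -leye_eq.
Qed.
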